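(* Let $\mathbb{D}$ be a domain and $\mathbb{D}_1, \ldots, \mathbb{D}_k \subseteq \mathbb{D}$ arbitrary subsets. Let $\mathcal{M} := \{M_i(D \cap \mathbb{D}_i)\}_{1\le i\le k}$ be mechanisms, where $M_i$ also receives the outputs of $M_1,\ldots,M_{i-1}$ and is $f_i$-differentially private (in its data argument, for every value of the previous outputs). Then the composition of $\mathcal{M}$ (the mechanism outputting all the outputs of $M_1,\dots,M_k$ run in sequence) is $f_\gamma$-differentially private, where $$f_\gamma := \mathrm{lce}\left\{ \bigotimes_{i\in I} f_i \;:\; I \subseteq \{1,\ldots,k\},\ \bigcap_{i \in I} \mathbb{D}_i \neq \emptyset \right\}.$$
   Context: An attribute is a finite set; a domain is $\mathbb{D} = A_1 \times \cdots \times A_m$; data sets are elements of $\mathbb{N}^{|\mathbb{D}|}$ (multisets of rows); $D\cap\mathbb{D}'$ denotes the rows of $D$ in $\mathbb{D}'$; neighboring data sets differ in a single row. For distributions $P,P'$, the trade-off function is $T(P,P')(\alpha) := \inf\{\beta_\phi : \alpha_\phi \le \alpha\}$ over measurable rejection rules $0\le\phi\le1$, with $\alpha_\phi = \mathbb{E}_P[\phi]$ and $\beta_\phi = 1-\mathbb{E}_{P'}[\phi]$. A mechanism $M$ is $f$-differentially private if $T(M(D),M(D'))\ge f$ for all neighboring $D,D'$. If $f = T(P_1,P_2)$ and $g = T(P_3,P_4)$, the tensor product is $f\otimes g := T(P_1\times P_3, P_2 \times P_4)$ (well defined and associative, so $n$-fold products make sense). The lower convex envelope of a family $F$ of trade-off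 functions is $\mathrm{lce}\, F (x) := \sup\{ f(x) : f \text{ convex}, f \le \min F\}$. *)

(* Defs.v *)
From HB Require Import structures.
From mathcomp Require Import all_boot all_order all_algebra.
From mathcomp Require Import all_classical all_reals all_analysis.

Set Implicit Arguments.
Unset Strict Implicit.
Unset Printing Implicit Defensive.

Import Order.TTheory GRing.Theory Num.Theory.
Local Open Scope classical_set_scope.
Local Open Scope ring_scope.

Definition domain (m : nat) (A : 'I_m -> finType) : finType :=
  {dffun forall j : 'I_m, A j}.

(* Data sets: multisets of rows, i.e. elements of N^{|D|}. *)
Definition dataset (Dom : finType) := {ffun Dom -> nat}.

Definition restrict (Dom : finType) (D : dataset Dom) (S : {set Dom})
  : dataset Dom := [ffun x => if x \in S then D x else 0%N].

Definition neighbors (Dom : finType) (D D' : dataset Dom) : Prop :=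
  exists x : Dom,
    (forall y, D' y = (D y + (y == x))%N) \/
    (forall y, D y = (D' y + (y == x))%N).

Section tradeoff.
Context {R : realType}.

(* T(P,P')(alpha) = inf { beta_phi : alpha_phi <= alpha } over measurable
   rejection rules 0 <= phi <= 1. *)
Definition tradeoff d (T : measurableType d) (P P' : set T -> \bar R)
    (alpha : R) : R :=
  inf [set beta : R | exists phi : T -> R,
    [/\ measurable_fun setT phi,
        (forall t, 0 <= phi t <= 1),
        fine (\int[P]_t (phi t)%:E) <= alpha &
        beta = 1 - fine (\int[P']_t (phi t)%:E)]].

Definition is_tradeoff_of d (T : measurableType d) (P P' : set T -> \bar R)
    (f : R -> R) : Prop :=
  forall alpha, 0 <= alpha <= 1 -> f alpha = tradeoff P P' alpha.

Definition is_tradeoff_fun (f : R -> R) : Prop :=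
  exists (d : measure_display) (T : measurableType d)
         (P P' : probability T R), is_tradeoff_of P P' f.

(* Tensor product: f (x) g := T(P1 x P3, P2 x P4) where f = T(P1,P2) and
   g = T(P3,P4) (the value does not depend on the chosen representations). *)
Definition tensor (f g : R -> R) : R -> R := fun alpha =>
  inf [set v : R | exists (d1 : measure_display) (T1 : measurableType d1)
                          (P1 P2 : probability T1 R)
                          (d2 : measure_display) (T2 : measurableType d2)
                          (P3 P4 : probability T2 R),
      [/\ is_tradeoff_of P1 P2 f, is_tradeoff_of P3 P4 g &
          v = tradeoff (P1 \x P3)%E (P2 \x P4)%E alpha]].

(* The identity trade-off function Id = T(P,P), unit of the tensor product
   (it is the value of the empty tensor product). *)
Definition tradeoff_id : R -> R := fun alpha => 1 - alpha.

Definition big_tensor (I : finType) (A : {set I}) (f : I -> R -> R)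
  : R -> R := \big[tensor/tradeoff_id]_(i in A) f i.

Definition convex01 (g : R -> R) : Prop :=
  forall x y t, 0 <= x <= 1 -> 0 <= y <= 1 -> 0 <= t <= 1 ->
    g (t * x + (1 - t) * y) <= t * g x + (1 - t) * g y.

Definition lce (F : set (R -> R)) (x : R) : R :=
  sup [set g x | g in [set g : R -> R | convex01 g /\
         forall h, F h -> forall y, 0 <= y <= 1 -> g y <= h y]].

Definition fDP (Dom : finType) d (T : measurableType d)
    (M : dataset Dom -> set T -> \bar R) (f : R -> R) : Prop :=
  forall D D', neighbors D D' ->
    forall alpha, 0 <= alpha <= 1 -> f alpha <= tradeoff (M D) (M D') alpha.

End tradeoff.

(* Measurable space of the outputs of the first i mechanisms:
   hist 0 = unit, hist (i+1) = hist i * Y i. *)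
Fixpoint hist (Y : nat -> {d : measure_display & measurableType d}) (i : nat)
  : {d : measure_display & measurableType d} :=
  match i with
  | 0 => existT measurableType _ (unit : measurableType _)
  | i.+1 => existT measurableType _
             ((projT2 (hist Y i) * projT2 (Y i))%type : measurableType _)
  end.

(* Joint law of the outputs of M_1, ..., M_i run in sequence on data set D:
   mechanism j (0-indexed) receives the previous outputs h and the data set
   D \cap Dsub j, and outputs according to the probability kernel M j.
   comp_law 0 = dirac at tt, and
   comp_law (j+1) (A) = \int_{h ~ comp_law j} M_j(h, D \cap D_j)(A_h). *)
Fixpoint comp_law {R : realType} (Dom : finType)
    (Y : nat -> {d : measure_display & measurableType d})
    (Dsub : nat -> {set Dom})
    (M : forall j : nat, dataset Dom ->
           R.-pker (projT2 (hist Y j)) ~> (projT2 (Y j)))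
    (D : dataset Dom) (i : nat) : set (projT2 (hist Y i)) -> \bar R :=
  match i return set (projT2 (hist Y i)) -> \bar R with
  | 0 => fun A => \d_tt A
  | j.+1 => fun A =>
      (\int[@comp_law R Dom Y Dsub M D j]_h
          M j (restrict D (Dsub j)) h (xsection A h))%E
  end.

(* f_gamma := lce { (x)_{i in I} f_i : I \subseteq {1..k},
                    \bigcap_{i in I} D_i <> \emptyset }
   (mechanisms / subsets / trade-off functions are indexed by 0..k-1;
    the empty intersection is the whole domain). *)
Definition f_gamma {R : realType} (Dom : finType) (k : nat)
    (Dsub : nat -> {set Dom}) (f : nat -> R -> R) : R -> R :=
  lce [set g | exists I : {set 'I_k},
         (\bigcap_(i in I) Dsub (val i) != finset.set0)%SET /\
         g = big_tensor I (fun i : 'I_k => f (val i))].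

(* Main.v *)
Require Import Defs.
From HB Require Import structures.
From mathcomp Require Import all_boot all_order all_algebra.
From mathcomp Require Import all_classical all_reals all_analysis.
From mathcomp Require Import measurable_realfun lra.

(** If the neighbouring data sets differ in the row [x], only the mechanisms
    with [x] in [D_i] see different data; let [I] be the set of their indices.
    Since [x] lies in the intersection of the [D_i], [i] in [I], the envelope
    [f_gamma] is below the tensor product over [I], so it suffices to bound the
    composition by that product.  A mechanism outside [I] is the same kernel on
    both sides and can be averaged out of a test.  For a mechanism in [I], a
    test [phi] on [m (x) K] is turned into a test on the product [m x Q] by
    replacing each section [phi (x, _)] by a test for [Q, Q'] of no larger level
    and nearly as large power.  This choice is measurable in [x] because
    countably many tests suffice: near-optimal tests at rational levels,
    combined with the convexity of the trade-off function towards level [0]. *)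

Set Implicit Arguments.
Unset Strict Implicit.
Unset Printing Implicit Defensive.

Import Order.TTheory GRing.Theory Num.Theory.
Local Open Scope classical_set_scope.
Local Open Scope ring_scope.

(** * Tests and their expectations *)

Section expectation.
Context {R : realType} d (T : measurableType d).
Implicit Types (P : {measure set T -> \bar R}) (phi psi : T -> R).

Definition is_test phi := measurable_fun setT phi /\ forall t, 0 <= phi t <= 1.

Definition expect (P : set T -> \bar R) phi : R := fine (\int[P]_t (phi t)%:E).

Lemma is_test_cst (c : R) : 0 <= c <= 1 -> is_test (cst c).
Proof. by move=> c01; split. Qed.

Lemma is_testZ (c : R) phi : 0 <= c <= 1 -> is_test phi ->
  is_test (fun t => c * phi t).
Proof.
move=> /andP[c0 c1] [mphi phi01]; split; first exact: measurable_funM.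
move=> t; have /andP[p0 p1] := phi01 t.
by rewrite mulr_ge0//= mulr_ile1.
Qed.

Lemma measurable_test phi : is_test phi ->
  measurable_fun setT (fun t => (phi t)%:E).
Proof. by move=> [mphi _]; exact/measurable_EFinP. Qed.

Section probability.
Variables (P : {measure set T -> \bar R}).
Hypothesis P1 : P setT = 1%E.

Lemma integral_test_itv phi : is_test phi ->
  (0 <= \int[P]_t (phi t)%:E <= 1)%E.
Proof.
move=> tphi; have [_ phi01] := tphi; apply/andP; split.
  by apply: integral_ge0 => t _; rewrite lee_fin; case/andP: (phi01 t).
rewrite -P1 -[leRHS]mul1e -integral_cst//.
apply: ge0_le_integral => //.
- by move=> t _; rewrite lee_fin; case/andP: (phi01 t).
- exact: measurable_test.
- by move=> t _; rewrite lee_fin; case/andP: (phi01 t).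
Qed.

Lemma expectE phi : is_test phi -> (\int[P]_t (phi t)%:E = (expect P phi)%:E)%E.
Proof.
move=> /integral_test_itv/andP[i0 i1]; rewrite /expect fineK// ge0_fin_numE//.
exact: le_lt_trans i1 (ltry _).
Qed.

Lemma expect_itv phi : is_test phi -> 0 <= expect P phi <= 1.
Proof.
by move=> tphi; have := integral_test_itv tphi; rewrite expectE// !lee_fin.
Qed.

Lemma expect_cst (c : R) : expect P (cst c) = c.
Proof. by rewrite /expect/= integral_cst// P1 mule1. Qed.

Lemma expectZ (c : R) phi : 0 <= c <= 1 -> is_test phi ->
  expect P (fun t => c * phi t) = c * expect P phi.
Proof.
move=> c01 tphi; apply: EFin_inj; rewrite -expectE; last exact: is_testZ.
under eq_integral do rewrite EFinM.
have [_ phi01] := tphi.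
rewrite ge0_integralZl//.
- by rewrite expectE// EFinM.
- exact: measurable_test.
- by move=> t _; rewrite lee_fin; case/andP: (phi01 t).
- by case/andP: c01.
Qed.

Lemma le_expectD phi psi (e : R) : 0 <= e -> is_test phi -> is_test psi ->
  (forall t, phi t <= psi t + e) -> expect P phi <= expect P psi + e.
Proof.
move=> e0 tphi tpsi le_e; rewrite -lee_fin EFinD -!expectE//.
have [_ phi01] := tphi; have [_ psi01] := tpsi.
rewrite -[e%:E]mule1 -P1 -integral_cst// -ge0_integralD//.
- apply: ge0_le_integral => //.
  + by move=> t _; rewrite lee_fin; case/andP: (phi01 t).
  + exact: measurable_test.
  + by apply: emeasurable_funD => //; exact: measurable_test.
  + by move=> t _; rewrite -EFinD lee_fin.
- by move=> t _; rewrite lee_fin; case/andP: (psi01 t).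
- exact: measurable_test.
Qed.

Lemma le_expect phi psi : is_test phi -> is_test psi ->
  (forall t, phi t <= psi t) -> expect P phi <= expect P psi.
Proof.
move=> tphi tpsi le_pp; rewrite -[leRHS]addr0.
by apply: le_expectD => // t; rewrite addr0.
Qed.

End probability.
End expectation.
Arguments is_test {R d T} phi.

(** * Trade-off functions, near-optimal tests, comparison by simulation *)

Section tradeoff_theory.
Context {R : realType}.

Section one_pair.
Context d (T : measurableType d) (P P' : {measure set T -> \bar R}).
Hypotheses (P1 : P setT = 1%E) (P'1 : P' setT = 1%E).
Implicit Type phi : T -> R.

Let rates (alpha : R) := [set beta : R | exists phi : T -> R,
    [/\ measurable_fun setT phi, (forall t, 0 <= phi t <= 1),
        expect P phi <= alpha & beta = 1 - expect P' phi]].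

Let has_inf_rates alpha : 0 <= alpha -> has_inf (rates alpha).
Proof.
move=> alpha0; split.
  exists 1, (cst 0); split=> //; first by move=> t; rewrite lexx/=.
  - by rewrite expect_cst.
  - by rewrite expect_cst// subr0.
exists 0 => _ [phi [mphi phi01 _ ->]].
by rewrite subr_ge0; have /andP[] := expect_itv P'1 (conj mphi phi01).
Qed.

Lemma tradeoff_le alpha phi : is_test phi -> expect P phi <= alpha ->
  tradeoff P P' alpha <= 1 - expect P' phi.
Proof.
move=> tphi level; have /andP[E0 _] := expect_itv P1 tphi.
have [mphi phi01] := tphi.
apply: ge_inf; first exact: (has_inf_rates (le_trans E0 level)).2.
by exists phi; split.
Qed.

Lemma le_tradeoff alpha c : 0 <= alpha ->
  (forall phi, is_test phi -> expect P phi <= alpha ->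
     c <= 1 - expect P' phi) ->
  c <= tradeoff P P' alpha.
Proof.
move=> alpha0 le_c; apply: lb_le_inf; first exact: (has_inf_rates alpha0).1.
by move=> _ [phi [mphi phi01 level ->]]; exact: le_c.
Qed.

Lemma tradeoff_adherent alpha e : 0 <= alpha -> 0 < e ->
  exists2 phi, is_test phi &
    expect P phi <= alpha /\ 1 - expect P' phi < tradeoff P P' alpha + e.
Proof.
move=> alpha0 e0.
have [_ [phi [mphi phi01 level ->]] lt_e] :=
  inf_adherent e0 (has_inf_rates alpha0).
by exists phi.
Qed.

Lemma tradeoff_ge0 alpha : 0 <= alpha -> 0 <= tradeoff P P' alpha.
Proof.
move=> alpha0; apply: le_tradeoff => // phi tphi _.
by rewrite subr_ge0; have /andP[] := expect_itv P'1 tphi.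
Qed.

(* Shrinking the level by a factor [beta / alpha] costs at most
   [1 - beta / alpha]: scale the test. *)
Lemma tradeoff_shrink alpha beta : 0 <= beta -> 0 < alpha -> beta <= alpha ->
  tradeoff P P' beta <= tradeoff P P' alpha + (1 - beta / alpha).
Proof.
move=> beta0 alpha0 le_ba.
have s01 : 0 <= beta / alpha <= 1.
  by rewrite (divr_ge0 beta0 (ltW alpha0)) ler_pdivrMr ?mul1r.
have /andP[s0 s1] := s01.
rewrite -lerBlDr; apply: le_tradeoff (ltW alpha0) _ => phi tphi level.
have level' : expect P (fun t => beta / alpha * phi t) <= beta.
  rewrite expectZ// -[leRHS](divfK (lt0r_neq0 alpha0)).
  exact: ler_wpM2l.
have := tradeoff_le (is_testZ s01 tphi) level'.
rewrite expectZ//; have /andP[E0 E1] := expect_itv P'1 tphi.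
have : (1 - beta / alpha) * expect P' phi <= 1 - beta / alpha.
  by rewrite ler_piMr// subr_ge0.
by rewrite mulrBl mul1r; lra.
Qed.

(* A rational level slightly below [alpha] loses little by [tradeoff_shrink];
   at [alpha = 0], where shrinking is useless, the level is itself rational. *)
Lemma countable_near_optimal_tests e : 0 < e ->
  exists psi : nat -> T -> R, (forall i, is_test (psi i)) /\
    forall alpha, 0 <= alpha -> exists i,
      expect P (psi i) <= alpha /\
      1 - expect P' (psi i) <= tradeoff P P' alpha + e.
Proof.
move=> e0; have e20 : 0 < e / 2 by rewrite divr_gt0.
(* Negative rationals get a dummy clause, so that [choice] can range over all of [rat]. *)
have near q : exists phi, is_test phi /\ (0 <= ratr q :> R ->
    expect P phi <= ratr q /\
    1 - expect P' phi < tradeoff P P' (ratr q) + e / 2).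
  have [q0|q0] := leP 0 (ratr q : R).
    by have [phi ? ?] := tradeoff_adherent q0 e20; exists phi.
  by exists (cst 0); split=> //; apply: is_test_cst; rewrite lexx/=.
have [net netP] := choice near.
exists (fun i => if unpickle i is Some q then net q else cst 0); split.
  move=> i; case: unpickle => [q|]; first by have [] := netP q.
  by apply: is_test_cst; rewrite lexx/=.
move=> alpha; rewrite le_eqVlt => /predU1P[<-|alpha0].
  exists (pickle (0 : rat)); rewrite pickleK.
  have [_ /(_ _)] := netP 0; rewrite rmorph0 => -[//|-> lt_e].
  by split=> //; apply: ltW; apply: lt_le_trans lt_e _; lra.
(* The error [e] is split in two: one half for the near-optimality of [net q], the other for moving
   the level from [alpha] down to [q]. The maximum keeps [q] positive when [1 - e / 2] is
   negative. *)
have lt_max : Num.max 0 ((1 - e / 2) * alpha) < alpha.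
  by rewrite gt_max alpha0/= gtr_pMl//; lra.
have [q] := rat_in_itvoo lt_max.
rewrite in_itv/= gt_max => /andP[/andP[q0 q1] q2].
exists (pickle q); rewrite pickleK.
have [_ /(_ (ltW q0))[le_q lt_e]] := netP q; split; first by lra.
have := tradeoff_shrink (ltW q0) alpha0 (ltW q2).
have : 1 - e / 2 < ratr q / alpha by rewrite ltr_pdivlMr.
lra.
Qed.

End one_pair.

(** Tests for [Q, Q'] are simulated by tests for [P, P'] of no larger level, with an arbitrarily
    small loss of power. Every comparison of joint laws below reduces to such a simulation. *)
Lemma tradeoff_transfer d1 d2 (T1 : measurableType d1) (T2 : measurableType d2)
    (P P' : {measure set T1 -> \bar R}) (Q Q' : {measure set T2 -> \bar R})
    (alpha : R) :
  P setT = 1%E -> P' setT = 1%E -> Q setT = 1%E -> Q' setT = 1%E ->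
  0 <= alpha ->
  (forall phi e, is_test phi -> 0 < e -> exists2 psi, is_test psi &
     expect P psi <= expect Q phi /\ expect Q' phi <= expect P' psi + e) ->
  tradeoff P P' alpha <= tradeoff Q Q' alpha.
Proof.
move=> P1 P'1 Q1 Q'1 alpha0 sim; apply: le_tradeoff => // phi tphi level.
apply/ler_addgt0Pr => e e0; have [psi tpsi [le1 le2]] := sim phi e tphi e0.
apply: le_trans (tradeoff_le P1 P'1 tpsi (le_trans le1 level)) _.
by lra.
Qed.

Lemma tradeoff_same d (T : measurableType d) (P : {measure set T -> \bar R})
    (alpha : R) : P setT = 1%E -> 0 <= alpha <= 1 ->
  tradeoff P P alpha = 1 - alpha.
Proof.
move=> P1 alpha01; have /andP[alpha0 _] := alpha01.
apply/eqP; rewrite eq_le; apply/andP; split.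
  (* The constant test [alpha] attains the bound, its power being equal to its level. *)
  rewrite -[in leRHS](expect_cst P1 alpha).
  apply: (tradeoff_le P1 P1); first exact: is_test_cst.
  by rewrite expect_cst.
by apply: le_tradeoff => // phi _ level; rewrite lerB.
Qed.

End tradeoff_theory.

(** * Measurable selection from countably many choices *)

Lemma measurable_nat_selection d (X : measurableType d) (A : nat -> set X) :
  (forall i, measurable (A i)) -> (forall x, exists i, A i x) ->
  exists n : X -> nat, (forall x, A (n x) x) /\
    forall i, measurable (n @^-1` [set i]).
Proof.
move=> mA covA.
(* Making the cover disjoint with [seqDU] selects the first index that works; the fibres of [n] are
   then the disjoint pieces, which are measurable. *)
have least x : exists i, seqDU A i x.
  have [i Aix] := covA x.
  have : (\bigcup_i A i) x by exists i.
  by rewrite seqDU_bigcup_eq => -[j _ Dj]; exists j.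
have [n nP] := choice least; exists n; split.
  by move=> x; have [] := nP x.
move=> i; rewrite (_ : _ @^-1` _ = seqDU A i).
  by apply: measurableD => //; apply: bigsetU_measurable.
apply/seteqP; split=> [x <-//|x Dix].
by apply: (@trivIset_seqDU _ A (n x) i) => //; exists x; split.
Qed.

(** The preimage of a measurable set is a countable union of measurable rectangles, one for each
    value of [n]. *)
Lemma measurable_glue d1 d2 d3 (X : measurableType d1) (Z : measurableType d2)
    (W : measurableType d3) (n : X -> nat) (psi : nat -> Z -> W) :
  (forall i, measurable (n @^-1` [set i])) ->
  (forall i, measurable_fun setT (psi i)) ->
  measurable_fun setT (fun xz : X * Z => psi (n xz.1) xz.2).
Proof.
move=> mn mpsi _ B mB; rewrite setTI.
rewrite (_ : _ @^-1` _ =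
    \bigcup_i ((n @^-1` [set i]) `*` (psi i @^-1` B))).
  apply: bigcupT_measurable => i; apply: measurableX => //.
  by rewrite -[X in measurable X]setTI; exact: mpsi.
apply/seteqP; split=> [[x z]/= Bxz|[x z] [i _ [/= <-]]//].
by exists (n x).
Qed.

(** * Joint law of an initial distribution and a kernel *)

Definition joint {R : realType} d1 d2 (X : measurableType d1)
    (Y : measurableType d2) (m : set X -> \bar R)
    (K : X -> {measure set Y -> \bar R}) : set (X * Y) -> \bar R :=
  fun A => (\int[m]_x K x (xsection A x))%E.

Section section_kernel.
Local Open Scope ereal_scope.
Context {R : realType} d1 d2 (X : measurableType d1) (Y : measurableType d2).
Variable K : R.-pker X ~> Y.

Lemma measurable_kernel_xsection A : measurable A ->
  measurable_fun setT (fun x => K x (xsection A x)).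
Proof.
by move=> mA; apply: measurable_fun_xsection_finite_kernel; rewrite inE.
Qed.

(* The dummy factor [unit] matches the shape of [kcomp], whose integration
   formula then applies to [joint]. *)
Definition section_kernel (ux : unit * X) : {measure set (X * Y) -> \bar R}.
Proof.
by refine (pushforward (K ux.2) (pair ux.2)); exact: pair1_measurable.
Defined.

Let measurable_section_kernel U : measurable U ->
  measurable_fun setT (section_kernel ^~ U).
Proof.
move=> mU; have := measurable_kernel_xsection mU.
rewrite (_ : section_kernel ^~ U = (fun x => K x (xsection U x)) \o snd).
  by move=> mK; exact: measurableT_comp.
by apply/funext => -[u x] /=; rewrite /pushforward xsectionE.
Qed.

HB.instance Definition _ := @isKernel.Build _ _ _ _ R section_kernel
  measurable_section_kernel.

Let section_kernel_prob ux : section_kernel ux setT = 1.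
Proof. by rewrite /= /pushforward preimage_setT prob_kernel. Qed.

HB.instance Definition _ := @Kernel_isProbability.Build _ _ _ _ R
  section_kernel section_kernel_prob.

End section_kernel.

Section joint_probability.
Local Open Scope ereal_scope.
Context {R : realType} d1 d2 (X : measurableType d1) (Y : measurableType d2).
Variables (m : probability X R) (K : R.-pker X ~> Y).

Let cst_kernel : R.-pker unit ~> X :=
  kprobability (measurable_cst (m : pprobability X R)).

(** Through this identification [joint] inherits the measure axioms and the iterated integration
    formula from kernel composition. *)
Let joint_kcomp : joint m K = kcomp cst_kernel (section_kernel K) tt.
Proof.
apply/funext => A; rewrite /joint /kcomp; apply: eq_integral => x _.
by rewrite /= /pushforward xsectionE.
Qed.

Let joint0 : joint m K set0 = 0.
Proof. by rewrite joint_kcomp measure0. Qed.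

Let joint_ge0 A : 0 <= joint m K A.
Proof. by rewrite joint_kcomp measure_ge0. Qed.

Let joint_sigma_additive : semi_sigma_additive (joint m K).
Proof. rewrite joint_kcomp; exact: measure_semi_sigma_additive. Qed.

HB.instance Definition _ := isMeasure.Build _ _ _ (joint m K)
  joint0 joint_ge0 joint_sigma_additive.

Lemma joint_setT : joint m K setT = 1.
Proof.
rewrite /joint; under eq_integral do rewrite xsectionE preimage_setT prob_kernel.
by rewrite integral_cst// mul1e; exact: probability_setT.
Qed.

HB.instance Definition _ := Measure_isProbability.Build _ _ _ (joint m K)
  joint_setT.

Lemma integral_joint f : (forall z, 0 <= f z) -> measurable_fun setT f ->
  \int[joint m K]_z f z = \int[m]_x \int[K x]_y f (x, y).
Proof.
move=> f0 mf; rewrite joint_kcomp integral_kcomp//.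
apply: eq_integral => x _.
by rewrite ge0_integral_pushforward// preimage_setT.
Qed.

End joint_probability.

Section sections_of_tests.
Context {R : realType} d1 d2 (X : measurableType d1) (Y : measurableType d2).
Variable phi : X * Y -> R.
Hypothesis tphi : is_test phi.

Lemma is_test_pair1 x : is_test (fun y => phi (x, y)).
Proof.
have [mphi phi01] := tphi; split; last by move=> y; exact: phi01.
exact: measurable_fun_pair2.
Qed.

Lemma is_test_swap : is_test (fun yx : Y * X => phi (yx.2, yx.1)).
Proof.
have [mphi phi01] := tphi; split; last by move=> ?; exact: phi01.
apply: (measurableT_comp mphi); exact: measurable_fun_pair.
Qed.

(** Levels and powers of the sections of a test thus become tests on [X]; measurability comes from
    integration against a finite kernel. *)
Lemma is_test_expect (K : R.-pker X ~> Y) :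
  is_test (fun x => expect (K x) (fun y => phi (x, y))).
Proof.
split; last by move=> x; apply: (@expect_itv _ _ _ (K x)) (is_test_pair1 x); exact: prob_kernel.
apply/measurable_EFinP.
rewrite (_ : _ \o _ = fun x => \int[K x]_y (phi (x, y))%:E)%E; last first.
  by apply/funext => x /=; rewrite (expectE (prob_kernel x) (is_test_pair1 x)).
apply: (measurable_fun_integral_finite_kernel (fun z => (phi z)%:E) K).
  by move=> z; have [_ phi01] := tphi; rewrite lee_fin; case/andP: (phi01 z).
exact: measurable_test.
Qed.

Lemma expect_joint (m : probability X R) (K : R.-pker X ~> Y) :
  expect (joint m K) phi =
  expect m (fun x => expect (K x) (fun y => phi (x, y))).
Proof.
apply: EFin_inj; rewrite -(expectE (probability_setT _) tphi).
rewrite -(expectE (probability_setT m) (is_test_expect K)).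
rewrite integral_joint//; last 2 first.
  - by move=> z; have [_ phi01] := tphi; rewrite lee_fin; case/andP: (phi01 z).
  - exact: measurable_test.
apply: eq_integral => x _.
by rewrite (expectE (prob_kernel x) (is_test_pair1 x)).
Qed.

End sections_of_tests.

(** * Comparison of product laws and joint laws *)

Definition const_kernel {R : realType} d1 d2 (X : measurableType d1)
    (Y : measurableType d2) (Q : probability Y R) : R.-pker X ~> Y :=
  kprobability (measurable_cst (Q : pprobability Y R)).

(** The product measure is itself defined by integrating sections, so results on [joint] cover
    independent products. *)
Lemma product_joint {R : realType} d1 d2 (X : measurableType d1)
    (Y : measurableType d2) (m : probability X R) (Q : probability Y R) :
  (m \x Q)%E = joint m (const_kernel X Q).
Proof. by []. Qed.

(** The simulating test is built for each [x] separately, so its level and power compare pointwise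
    in [x] and the comparison survives integration against arbitrary [m] and [m']. *)
Lemma tradeoff_product_joint {R : realType} d1 d2 d3 (X : measurableType d1)
    (Y : measurableType d2) (Z : measurableType d3) (m m' : probability X R)
    (Q Q' : probability Z R) (K K' : R.-pker X ~> Y) (alpha : R) :
  (forall x a, 0 <= a <= 1 -> tradeoff Q Q' a <= tradeoff (K x) (K' x) a) ->
  0 <= alpha ->
  tradeoff (m \x Q)%E (m' \x Q')%E alpha <=
  tradeoff (joint m K) (joint m' K') alpha.
Proof.
move=> QK alpha0; rewrite !product_joint.
apply: (tradeoff_transfer (joint_setT _ _) (joint_setT _ _) (joint_setT _ _)
  (joint_setT _ _) alpha0).
move=> phi e tphi e0.
have [psi [tpsi near_opt]] := countable_near_optimal_tests
  (probability_setT Q) (probability_setT Q') e0.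
have ta := is_test_expect tphi K; have tb := is_test_expect tphi K'.
(* [a x] is the level and [b x] the power of the section of [phi] at [x]. *)
set a := (fun x => expect (K x) _) in ta.
set b := (fun x => expect (K' x) _) in tb.
(* The points where [psi i] can replace the section of [phi]: no larger level, and at most [e] of
   power lost. *)
pose A i := [set x | expect Q (psi i) <= a x] `&`
            [set x | b x <= expect Q' (psi i) + e].
have mA i : measurable (A i).
  have [ma _] := ta; have [mb _] := tb.
  apply: measurableI.
    rewrite [X in measurable X](_ : _ = setT `&` a @^-1` `[expect Q (psi i), +oo[).
      exact: ma.
    by apply/seteqP; split=> x; rewrite /= in_itv/= andbT => // -[].
  rewrite [X in measurable X](_ : _ = setT `&` b @^-1` `]-oo, expect Q' (psi i) + e]).
    exact: mb.
  by apply/seteqP; split=> x; rewrite /= in_itv/= => // -[].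
have covA x : exists i, A i x.
  have [_ /(_ x) a01] := ta; have /andP[a0 _] := a01.
  have [i [le_a le_T]] := near_opt _ a0; exists i; split=> //=.
  (* The section is one of the tests over which this trade-off is minimised; [QK] then carries the
     bound over to [Q, Q']. *)
  have Tab : tradeoff (K x) (K' x) (a x) <= 1 - b x.
    by apply: (tradeoff_le _ _ (is_test_pair1 tphi x)); rewrite ?prob_kernel.
  have := QK x _ a01; lra.
have [n [nA mn]] := measurable_nat_selection mA covA.
pose chi xz := psi (n xz.1) xz.2.
have tchi : is_test chi.
  split; last by move=> xz; have [_ +] := tpsi (n xz.1); exact.
  exact: (measurable_glue mn (fun i => (tpsi i).1)).
exists chi => //; rewrite !expect_joint//; split.
  apply: le_expect => //; first exact: probability_setT.
  - exact: is_test_expect.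
  - by move=> x; have [] := nA x.
apply: le_expectD => //; [exact: probability_setT|exact: ltW| |].
- exact: is_test_expect.
- by move=> x; have [] := nA x.
Qed.

(** By Tonelli, exchanging the arguments of a test preserves its expectation under the exchanged
    product. *)
Lemma tradeoff_product_swap {R : realType} d1 d2 (X : measurableType d1)
    (Y : measurableType d2) (P P' : probability X R) (Q Q' : probability Y R)
    (alpha : R) : 0 <= alpha ->
  tradeoff (P \x Q)%E (P' \x Q')%E alpha <=
  tradeoff (Q \x P)%E (Q' \x P')%E alpha.
Proof.
move=> alpha0.
have swapE (m : probability X R) (q : probability Y R) phi : is_test phi ->
    expect (joint m (const_kernel X q)) (fun xy => phi (xy.2, xy.1)) =
    expect (joint q (const_kernel Y m)) phi.
  rewrite -!product_joint => tphi; have [_ phi01] := tphi.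
  have phi0 z : (0 <= (phi z)%:E)%E by rewrite lee_fin; case/andP: (phi01 z).
  rewrite /expect fubini_tonelli1 ?fubini_tonelli2//.
  - exact: measurable_test.
  - exact: (measurable_test (is_test_swap tphi)).
rewrite !product_joint.
apply: (tradeoff_transfer (joint_setT _ _) (joint_setT _ _) (joint_setT _ _)
  (joint_setT _ _) alpha0).
move=> phi e tphi e0; exists (fun xy => phi (xy.2, xy.1)).
  exact: is_test_swap.
rewrite !swapE//; split=> //.
by rewrite lerDl ltW.
Qed.

(* Averaging over the kernel turns a test on the joint law into a test on the
   first marginal. *)
Lemma tradeoff_joint_same_kernel {R : realType} d1 d2 (X : measurableType d1)
    (Y : measurableType d2) (m m' : probability X R) (K : R.-pker X ~> Y)
    (alpha : R) : 0 <= alpha ->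
  tradeoff m m' alpha <= tradeoff (joint m K) (joint m' K) alpha.
Proof.
move=> alpha0.
apply: (tradeoff_transfer (probability_setT _) (probability_setT _)
  (joint_setT _ _) (joint_setT _ _) alpha0).
move=> phi e tphi e0; exists (fun x => expect (K x) (fun y => phi (x, y))).
  exact: is_test_expect.
by rewrite !expect_joint//; split=> //; rewrite lerDl ltW.
Qed.

(** Both sides unfold to the same threefold iterated expectation. *)
Lemma expect_product_assoc {R : realType} d1 d2 d3 (X : measurableType d1)
    (Y : measurableType d2) (Z : measurableType d3) (P : probability X R)
    (Q : probability Y R) (S : probability Z R) (phi : X * (Y * Z) -> R) :
  is_test phi ->
  expect (joint P (const_kernel X (joint Q (const_kernel Y S)))) phi =
  expect (joint (joint P (const_kernel X Q)) (const_kernel (X * Y)%type S))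
    (fun w => phi (w.1.1, (w.1.2, w.2))).
Proof.
move=> tphi.
have tpsi : is_test (fun w : X * Y * Z => phi (w.1.1, (w.1.2, w.2))).
  have [mphi phi01] := tphi; split; last by move=> ?; exact: phi01.
  apply: (measurableT_comp mphi); apply: measurable_fun_pair => /=.
    exact: measurableT_comp.
  by apply: measurable_fun_pair => //=; exact: measurableT_comp.
rewrite expect_joint// (expect_joint tpsi).
rewrite (expect_joint (is_test_expect tpsi (const_kernel _ S))).
congr expect; apply/funext => x.
exact: (expect_joint (is_test_pair1 tphi x) Q (const_kernel Y S)).
Qed.

Lemma tradeoff_product_assoc {R : realType} d1 d2 d3 (X : measurableType d1)
    (Y : measurableType d2) (Z : measurableType d3) (P P' : probability X R)
    (Q Q' : probability Y R) (S S' : probability Z R) (alpha : R) : 0 <= alpha ->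
  tradeoff (joint P (const_kernel X (joint Q (const_kernel Y S))))
           (joint P' (const_kernel X (joint Q' (const_kernel Y S')))) alpha <=
  tradeoff (joint (joint P (const_kernel X Q)) (const_kernel (X * Y)%type S))
           (joint (joint P' (const_kernel X Q')) (const_kernel (X * Y)%type S'))
           alpha.
Proof.
move=> alpha0.
apply: (tradeoff_transfer (joint_setT _ _) (joint_setT _ _) (joint_setT _ _)
  (joint_setT _ _) alpha0) => phi e [mphi phi01] e0.
have tpsi : is_test (fun w : X * (Y * Z) => phi ((w.1, w.2.1), w.2.2)).
  split; last by move=> ?; exact: phi01.
  apply: (measurableT_comp mphi); apply: measurable_fun_pair => /=.
    by apply: measurable_fun_pair => //=; exact: measurableT_comp.
  exact: measurableT_comp.
exists (fun w => phi ((w.1, w.2.1), w.2.2)) => //.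
rewrite !expect_product_assoc//=.
have -> : (fun w => phi (w.1.1, w.1.2, w.2)) = phi.
  by apply/funext => -[[]].
by split=> //; rewrite lerDl ltW.
Qed.

(* Replace the second factor first, then, through a swap of the factors, the
   first one. *)
Lemma tradeoff_product_le {R : realType} d1 d2 d3 d4 (X : measurableType d1)
    (Y : measurableType d2) (Z : measurableType d3) (W : measurableType d4)
    (P P' : probability X R) (Q Q' : probability Y R) (m m' : probability Z R)
    (K K' : R.-pker Z ~> W) (alpha : R) :
  (forall a, 0 <= a <= 1 -> tradeoff P P' a <= tradeoff m m' a) ->
  (forall z a, 0 <= a <= 1 -> tradeoff Q Q' a <= tradeoff (K z) (K' z) a) ->
  0 <= alpha ->
  tradeoff (P \x Q)%E (P' \x Q')%E alpha <=
  tradeoff (joint m K) (joint m' K') alpha.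
Proof.
move=> Pm QK alpha0.
apply: (le_trans (tradeoff_product_swap P P' Q Q' alpha0)).
apply: le_trans (tradeoff_product_joint m m' QK alpha0).
apply: le_trans (tradeoff_product_swap Q Q' m m' alpha0).
(* With [Q] now in front, [m] is read as a constant kernel, and the same lemma replaces [P] by
   [m]. *)
by rewrite [leRHS]/tradeoff !product_joint; apply: tradeoff_product_joint.
Qed.

(** * Tensor products of trade-off functions *)

Section tensor_theory.
Context {R : realType}.
Implicit Types (f g : R -> R).

Lemma tensor_le_product f g d1 d2 (X : measurableType d1)
    (Y : measurableType d2) (P P' : probability X R) (Q Q' : probability Y R)
    (alpha : R) : 0 <= alpha ->
  is_tradeoff_of P P' f -> is_tradeoff_of Q Q' g ->
  tensor f g alpha <= tradeoff (P \x Q)%E (P' \x Q')%E alpha.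
Proof.
move=> alpha0 Pf Qg; apply: ge_inf; last first.
  by exists d1, X, P, P', d2, Y, Q, Q'.
(* The bound [ge_inf] requires the set of values to be bounded below; trade-offs are nonnegative. *)
exists 0 => _ [? [? [p [p' [? [? [q [q' [_ _ ->]]]]]]]]].
by rewrite !product_joint tradeoff_ge0//; exact: joint_setT.
Qed.

(** One step of adaptive composition: [m] is the law of the history and [K] the next mechanism,
    whose bound [g] is uniform in the history. *)
Lemma tensor_le_joint f g d1 d2 (X : measurableType d1)
    (Y : measurableType d2) (m m' : probability X R) (K K' : R.-pker X ~> Y)
    (alpha : R) :
  is_tradeoff_fun f -> is_tradeoff_fun g ->
  (forall a, 0 <= a <= 1 -> f a <= tradeoff m m' a) ->
  (forall x a, 0 <= a <= 1 -> g a <= tradeoff (K x) (K' x) a) ->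
  0 <= alpha ->
  tensor f g alpha <= tradeoff (joint m K) (joint m' K') alpha.
Proof.
move=> [? [? [P [P' Pf]]]] [? [? [Q [Q' Qg]]]] fm gK alpha0.
apply: le_trans (tensor_le_product alpha0 Pf Qg) _.
apply: tradeoff_product_le => // [a a01|x a a01]; first by rewrite -Pf// fm.
by rewrite -Qg// gK.
Qed.

(** This is the independence of [tensor] from the representing pairs: any other choice is compared
    with this one by [tradeoff_product_le] with constant kernels. *)
Lemma tensor_tradeoff_of f g d1 d2 (X : measurableType d1)
    (Y : measurableType d2) (P P' : probability X R) (Q Q' : probability Y R) :
  is_tradeoff_of P P' f -> is_tradeoff_of Q Q' g ->
  is_tradeoff_of (joint P (const_kernel X Q)) (joint P' (const_kernel X Q'))
    (tensor f g).
Proof.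
move=> Pf Qg alpha alpha01; have /andP[alpha0 _] := alpha01.
apply/eqP; rewrite eq_le; apply/andP; split.
  exact: tensor_le_product.
apply: lb_le_inf.
  by exists (tradeoff (P \x Q)%E (P' \x Q')%E alpha), d1, X, P, P', d2, Y, Q, Q'.
move=> _ [? [? [p [p' [? [? [q [q' [pf qg ->]]]]]]]]].
apply: (@tradeoff_product_le R _ _ _ _ _ _ _ _ P P' Q Q' p p'
  (const_kernel _ q) (const_kernel _ q')) => // [a a01|z a a01].
  by rewrite -(Pf a a01) -(pf a a01).
by rewrite -(Qg a a01); have <- := qg a a01.
Qed.

Lemma is_tradeoff_fun_tensor f g :
  is_tradeoff_fun f -> is_tradeoff_fun g -> is_tradeoff_fun (tensor f g).
Proof.
move=> [? [? [P [P' Pf]]]] [? [? [Q [Q' Qg]]]].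
by do 4 eexists; exact: (tensor_tradeoff_of Pf Qg).
Qed.

Lemma is_tradeoff_fun_id : is_tradeoff_fun (@tradeoff_id R).
Proof.
exists _, unit, (dirac tt : probability unit R), (dirac tt : probability unit R).
by move=> alpha alpha01; rewrite tradeoff_same//; exact: probability_setT.
Qed.

Lemma is_tradeoff_fun_big (I : eqType) (f : I -> R -> R) (s : seq I) :
  (forall i, i \in s -> is_tradeoff_fun (f i)) ->
  is_tradeoff_fun (\big[@tensor R/@tradeoff_id R]_(i <- s) f i).
Proof.
move=> tf; rewrite big_seq.
apply: (big_ind is_tradeoff_fun) => //; first exact: is_tradeoff_fun_id.
exact: is_tradeoff_fun_tensor.
Qed.

(** The big operator nests to the right, whereas running one more mechanism multiplies the whole
    product on the right; this lemma bridges the two by reassociating. *)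
Lemma le_tensor_rcons (I : eqType) (f : I -> R -> R) (s : seq I) (k : I) :
  (forall i, i \in rcons s k -> is_tradeoff_fun (f i)) ->
  forall alpha, 0 <= alpha <= 1 ->
  (\big[@tensor R/@tradeoff_id R]_(i <- rcons s k) f i) alpha <=
  tensor (\big[@tensor R/@tradeoff_id R]_(i <- s) f i) (f k) alpha.
Proof.
elim: s => [|i s IHs] tf alpha alpha01; have /andP[alpha0 _] := alpha01.
  have [dX [X [P [P' Pf]]]] := tf k (mem_head _ _).
  have [dY [Y [Q [Q' Qg]]]] := is_tradeoff_fun_id.
  (* For one factor the unit sits on opposite sides, hence the swap. *)
  rewrite /= big_cons big_nil (tensor_tradeoff_of Pf Qg)//.
  rewrite (tensor_tradeoff_of Qg Pf)//.
  exact: (tradeoff_product_swap P P' Q Q' alpha0).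
have tfs j : j \in rcons s k -> is_tradeoff_fun (f j).
  by move=> js; apply: tf; rewrite rcons_cons in_cons js orbT.
have [dX [X [P [P' Pf]]]] := tf i (mem_head _ _).
have [dY [Y [Q [Q' Qs]]]] : is_tradeoff_fun
    (\big[@tensor R/@tradeoff_id R]_(j <- s) f j).
  by apply: is_tradeoff_fun_big => j js; apply: tfs; rewrite mem_rcons in_cons js orbT.
have [dZ [Z [S [S' Sk]]]] : is_tradeoff_fun (f k).
  by apply: tfs; rewrite mem_rcons mem_head.
rewrite rcons_cons !big_cons.
rewrite (tensor_tradeoff_of (tensor_tradeoff_of Pf Qs) Sk)//.
apply: le_trans (tradeoff_product_assoc P P' Q Q' S S' alpha0).
apply: tensor_le_joint => //; [exact: tf (mem_head _ _)| | |].
- exact: is_tradeoff_fun_big.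
- by move=> a a01; rewrite Pf.
- move=> z a a01; apply: le_trans (IHs tfs a a01) _.
  by rewrite (tensor_tradeoff_of Qs Sk).
Qed.

End tensor_theory.

(** * Composition of the mechanisms *)

Lemma comp_law_probability {R : realType} (Dom : finType)
    (Y : nat -> {d : measure_display & measurableType d})
    (Dsub : nat -> {set Dom})
    (M : forall j : nat, dataset Dom ->
           R.-pker (projT2 (hist Y j)) ~> (projT2 (Y j)))
    (D : dataset Dom) (i : nat) :
  exists P : probability (projT2 (hist Y i)) R,
    comp_law Dsub M D (i := i) = P.
Proof.
elim: i => [|i [P PE]]; first by exists (dirac tt).
exists (joint P (M i (Defs.restrict D (Dsub i)))).
by apply/funext => B; rewrite /= PE.
Qed.

Lemma neighbors_restrict (Dom : finType) (D D' : dataset Dom) (x : Dom)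
    (S : {set Dom}) :
  (forall y, D' y = (D y + (y == x))%N) \/
  (forall y, D y = (D' y + (y == x))%N) ->
  if x \in S then neighbors (Defs.restrict D S) (Defs.restrict D' S)
  else Defs.restrict D S = Defs.restrict D' S.
Proof.
move=> DD'; case: ifPn => xS.
  exists x; case: DD' => DD'; [left|right] => y; rewrite !ffunE DD';
  by case: ifPn => // yS; case: eqP => // yx; move: yS; rewrite yx xS.
apply/ffunP => y; rewrite !ffunE; case: ifPn => // yS.
have /negPf yx : y != x by apply: contraNneq xS => <-.
by case: DD' => ->; rewrite yx addn0.
Qed.

Lemma lce_le {R : realType} (F : set (R -> R)) (h : R -> R) (x c : R) :
  F h -> 0 <= x <= 1 -> h x <= c -> 0 <= c -> lce F x <= c.
Proof.
move=> Fh x01 hc c0; rewrite /lce; set E := [set _ | _ in _].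
(* If there is no convex minorant, [sup] takes its default value [0], whence the assumption
   [0 <= c]. *)
have [->|/set0P E0] := eqVneq E classical_sets.set0; first by rewrite sup0.
apply: ge_sup => // _ [g [_ gle] <-].
exact: le_trans (gle h Fh x x01) hc.
Qed.

(** Induction on the number of mechanisms, with the differing row [x] fixed. Indices are kept in a
    list, so that the last mechanism is either appended or dropped by the filter. *)
Lemma comp_law_tradeoff {R : realType} (Dom : finType) (k : nat)
    (Y : nat -> {d : measure_display & measurableType d})
    (Dsub : nat -> {set Dom})
    (M : forall j : nat, dataset Dom ->
           R.-pker (projT2 (hist Y j)) ~> (projT2 (Y j)))
    (f : nat -> R -> R) (D D' : dataset Dom) (x : Dom) :
  (forall i, (i < k)%N -> is_tradeoff_fun (f i)) ->
  (forall i, (i < k)%N -> forall h : projT2 (hist Y i),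
      fDP (fun D => M i D h) (f i)) ->
  (forall y, D' y = (D y + (y == x))%N) \/
  (forall y, D y = (D' y + (y == x))%N) ->
  forall alpha, 0 <= alpha <= 1 ->
  (\big[@tensor R/@tradeoff_id R]_(i <- [seq i <- iota 0 k | x \in Dsub i])
     f i) alpha <=
  tradeoff (comp_law Dsub M D (i := k)) (comp_law Dsub M D' (i := k)) alpha.
Proof.
move=> + + DD'.
elim: k => [|k IHk] tf dpM alpha alpha01; have /andP[alpha0 _] := alpha01.
  have tt1 : (dirac tt : {measure set unit -> \bar R}) setT = 1%E.
    exact: probability_setT.
  (* Nothing has been output: both laws are the Dirac mass at [tt], whose trade-off is the empty
     product. *)
  by rewrite big_nil -[leLHS](tradeoff_same tt1 alpha01).
have {}IHk := IHk (fun i ik => tf i (ltnW ik)) (fun i ik => dpM i (ltnW ik)).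
have [P PE] := comp_law_probability Dsub M D k.
have [P' PE'] := comp_law_probability Dsub M D' k.
(* [joint] copies the successor case of [comp_law], so this holds by computation. *)
have compE E : comp_law Dsub M E (i := k.+1) =
    joint (comp_law Dsub M E (i := k)) (M k (Defs.restrict E (Dsub k))) by [].
rewrite !compE PE PE'; rewrite PE PE' in IHk.
have := neighbors_restrict (Dsub k) DD'.
have -> : iota 0 k.+1 = rcons (iota 0 k) k.
  by rewrite -addn1 iotaD add0n cats1.
rewrite filter_rcons; case: ifPn => xk nDD'.
  set s := [seq i <- _ | _].
  have tfs i : i \in rcons s k -> is_tradeoff_fun (f i).
    rewrite mem_rcons in_cons mem_filter mem_iota add0n.
    by move=> /predU1P[->|/andP[_ ik]]; apply: tf => //; exact: ltnW.
  apply: le_trans (le_tensor_rcons tfs alpha01) _.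
  apply: tensor_le_joint => //.
  - apply: is_tradeoff_fun_big => i si; apply: tfs.
    by rewrite mem_rcons in_cons si orbT.
  - exact: tf.
  - by move=> h a a01; exact: dpM.
rewrite nDD'; apply: le_trans (IHk alpha alpha01) _.
exact: tradeoff_joint_same_kernel.
Qed.

Theorem theorem6 (R : realType) (m : nat) (A : 'I_m -> finType) (k : nat)
    (Dsub : nat -> {set domain A})
    (Y : nat -> {d : measure_display & measurableType d})
    (M : forall j : nat, dataset (domain A) ->
           R.-pker (projT2 (hist Y j)) ~> (projT2 (Y j)))
    (f : nat -> R -> R) :
  (forall i, (i < k)%N -> is_tradeoff_fun (f i)) ->
  (forall i, (i < k)%N -> forall h : projT2 (hist Y i),
      fDP (fun D => M i D h) (f i)) ->
  fDP (fun D => @comp_law R _ Y Dsub M D k) (f_gamma k Dsub f).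
Proof.
move=> tf dpM D D' [x DD'] alpha alpha01; have /andP[alpha0 _] := alpha01.
pose I := [set i : 'I_k | x \in Dsub (val i)]%SET.
apply: (lce_le (h := big_tensor I (fun i : 'I_k => f (val i)))) => //.
- exists I; split=> //; apply/set0Pn; exists x.
  by apply/bigcapP => i; rewrite inE.
(* The product over ordinals in [I] is rewritten over the filtered list of naturals, in the same
   order. *)
- rewrite /big_tensor (eq_bigl (fun i : 'I_k => x \in Dsub i)); last first.
    by move=> i; rewrite inE.
  rewrite -(big_mkord (fun i => x \in Dsub i) f) -big_filter /index_iota subn0.
  exact: comp_law_tradeoff.
(* The remaining goal is the nonnegativity demanded by [lce_le]. *)
have [P ->] := comp_law_probability Dsub M D k.
have [P' ->] := comp_law_probability Dsub M D' k.
by apply: tradeoff_ge0 => //; exact: probability_setT.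
Qed.
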